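(* Let $F$ be an arbitrary field and let $m\geq 3$ be the degree of a cyclic Galois extension $K/F$. For any two distinct generators $\sigma_1\neq\sigma_2$ of the Galois group $\mathrm{Gal}(K/F)$, and for any $a_1,a_2\in K\smallsetminus F$, the algebras are not isomorphic: $$(K/F,\sigma_1,a_1)\not\cong (K/F,\sigma_2,a_2).$$
   Context: Let $K/F$ be a cyclic Galois extension of degree $m$, $\sigma$ a generator of $\mathrm{Gal}(K/F)$ and $a\in K^\times$. The nonassociative cyclic algebra $(K/F,\sigma,a)$ of degree $m$ is the unital $F$-algebra of dimension $m^2$ with underlying left $K$-vector space $\bigoplus_{s=0}^{m-1}Kt^s$ and $F$-bilinear multiplication given, for $0\le s,s'<m$ and $k,k'\in K$, by $(kt^s)(k't^{s'})=k\sigma^s(k')t^{s+s'}$ if $s+s'<m$, and $(kt^s)(k't^{s'})=k\sigma^s(k')a\,t^{s+s'-m}$ if $s+s'\ge m$. It is not associative when $a\in K\smallsetminus F$. Isomorphism means isomorphism of $F$-algebras. *)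

(* Defs.v *)
From HB Require Import structures.
From mathcomp Require Import all_boot all_order all_algebra all_fingroup.
From mathcomp Require Import all_solvable all_field.
From mathcomp Require Import sesquilinear.

Set Implicit Arguments.
Unset Strict Implicit.
Unset Printing Implicit Defensive.

Import GRing.Theory.
Local Open Scope ring_scope.

(* Unital, not necessarily associative, algebras over a field. *)
Record naAlg (F : fieldType) := NaAlg {
  na_sort :> lmodType F;
  na_mul : {bilinear na_sort -> na_sort -> na_sort};
  na_one : na_sort;
  na_mul1r : left_id na_one na_mul;
  na_mulr1 : right_id na_one na_mul }.

Definition naAlg_isomorphic (F : fieldType) (A B : naAlg F) : Prop :=
  exists f : {linear A -> B},
    [/\ bijective f, f (na_one A) = na_one B &
        {morph f : x y / na_mul A x y >-> na_mul B x y}].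

Section CyclicAlgebra.

Variables (F : fieldType) (L : splittingFieldType F).
Local Notation m := (\dim {:L}).

(* The field K of the cyclic algebra is the full space {:L}, and F is 1%VS.   *)
(* An element \sum_(s < m) x_s t^s is the finite function s |-> x_s.          *)
Local Notation cyc_space := {ffun 'I_m -> L}.

Implicit Types (sigma : gal_of {:L}) (a k : L) (x y : cyc_space).

(* k t^s; this is 0 when s >= m, a case that never occurs below. *)
Definition cyc_mono k (s : nat) : cyc_space :=
  [ffun r : 'I_m => if r == s :> nat then k else 0].

Definition cyc_mono_mul sigma a k (s : nat) k' (s' : nat) : cyc_space :=
  if (s + s' < m)%N then cyc_mono (k * (sigma ^+ s)%g k') (s + s')
  else cyc_mono (k * (sigma ^+ s)%g k' * a) (s + s' - m).

Definition cyc_mul sigma a x y : cyc_space :=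
  \sum_(s < m) \sum_(s' < m) cyc_mono_mul sigma a (x s) s (y s') s'.

Definition cyc_one : cyc_space := cyc_mono 1 0.

Lemma cyc_mono_is_linear s : linear (cyc_mono^~ s).
Proof.
move=> c u v; apply/ffunP=> r; rewrite !ffunE.
by case: eqP => _ //; rewrite scaler0 addr0.
Qed.

Lemma cyc_mono0 s : cyc_mono 0 s = 0.
Proof. by apply/ffunP=> r; rewrite !ffunE; case: eqP. Qed.

Lemma cyc_sum_mono x : \sum_(s < m) cyc_mono (x s) s = x.
Proof.
apply/ffunP=> r; rewrite sum_ffunE (bigD1 r) //= ffunE eqxx big1 ?addr0 //.
by move=> s ne_sr; rewrite ffunE val_eqE eq_sym (negPf ne_sr).
Qed.

Lemma cyc_mono_mul_linearl sigma a s k' s' :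
  linear (fun k => cyc_mono_mul sigma a k s k' s').
Proof.
move=> c u v; rewrite /cyc_mono_mul; case: ifP => _;
by rewrite !(mulrDl, =^~ scalerAl) cyc_mono_is_linear.
Qed.

Lemma cyc_mono_mul_linearr sigma a k s s' :
  linear (fun k' => cyc_mono_mul sigma a k s k' s').
Proof.
move=> c u v; rewrite /cyc_mono_mul; case: ifP => _;
by rewrite linearP mulrDr ?mulrDl -scalerAr -?scalerAl cyc_mono_is_linear.
Qed.

Lemma cyc_mul_bilinear sigma a : bilinear_for *:%R *:%R (cyc_mul sigma a).
Proof.
split=> [y c u v|x c u v]; rewrite /= /cyc_mul scaler_sumr -big_split;
apply: eq_bigr => s _; rewrite scaler_sumr -big_split;
apply: eq_bigr => s' _; rewrite !ffunE.
- exact: cyc_mono_mul_linearl.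
- exact: cyc_mono_mul_linearr.
Qed.

HB.instance Definition _ sigma a :=
  bilinear_isBilinear.Build F cyc_space cyc_space cyc_space *:%R *:%R
    (cyc_mul sigma a) (cyc_mul_bilinear sigma a).

Lemma cyc_mul_mono sigma a k s k' s' : (s < m)%N -> (s' < m)%N ->
  cyc_mul sigma a (cyc_mono k s) (cyc_mono k' s')
    = cyc_mono_mul sigma a k s k' s'.
Proof.
move=> lt_s lt_s'; rewrite /cyc_mul.
have z1 r r' l : cyc_mono_mul sigma a 0 r l r' = 0.
  by rewrite /cyc_mono_mul !mul0r !cyc_mono0 if_same.
have z2 r r' l : cyc_mono_mul sigma a l r 0 r' = 0.
  by rewrite /cyc_mono_mul rmorph0 mulr0 mul0r !cyc_mono0 if_same.
rewrite (bigD1 (Ordinal lt_s)) //= [X in _ + X]big1 ?addr0 => [|i ne_i].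
  rewrite (bigD1 (Ordinal lt_s')) //= [X in _ + X]big1 ?addr0 => [|j ne_j].
    by rewrite !ffunE /= !eqxx.
  by rewrite [cyc_mono k' _ _]ffunE -(inj_eq val_inj) /= in ne_j *;
     rewrite (negPf ne_j) z2.
apply: big1 => j _; rewrite -(inj_eq val_inj) /= in ne_i.
by rewrite [cyc_mono k _ _]ffunE (negPf ne_i) z1.
Qed.

Lemma cyc_mul1 sigma a : left_id cyc_one (cyc_mul sigma a).
Proof.
move=> x; rewrite -{1}(cyc_sum_mono x) linear_sumr -[RHS]cyc_sum_mono.
apply: eq_bigr => s _ /=.
by rewrite cyc_mul_mono ?adim_gt0 // /cyc_mono_mul add0n ltn_ord expg0 gal_id mul1r.
Qed.

Lemma cyc_mulr1 sigma a : right_id cyc_one (cyc_mul sigma a).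
Proof.
move=> x; rewrite -{1}(cyc_sum_mono x) linear_sumlz -[RHS]cyc_sum_mono.
apply: eq_bigr => s _ /=.
by rewrite cyc_mul_mono ?adim_gt0 // /cyc_mono_mul addn0 ltn_ord rmorph1 mulr1.
Qed.

Lemma dim_cyc_space : \dim {:cyc_space} = (m ^ 2)%N.
Proof. by rewrite dimvf /dim /= card_ord -dimvf. Qed.

(* The nonassociative cyclic algebra (K/F, sigma, a). *)
Definition cycAlg sigma a : naAlg F :=
  @NaAlg F cyc_space (cyc_mul sigma a) cyc_one
    (cyc_mul1 sigma a) (cyc_mulr1 sigma a).

End CyclicAlgebra.

(* Main.v *)
From HB Require Import structures.
Require Import Defs.
From mathcomp Require Import all_boot all_order all_algebra all_fingroup.
From mathcomp Require Import all_solvable all_field.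

(** In A = (K/F, sigma, a) the associator of the monomials
    (k t^i, k' t^j, k'' t^l) vanishes as soon as j + l < m, whereas for i = 1
    and j + l >= m it is a nonzero multiple of a - sigma a, and sigma a <> a
    because a is not in F. Two consequences carry the proof.

    First, the right nucleus of A is K ([cyc_assoc_K], [cyc_right_nucleus]),
    so an isomorphism f from (K/F, sigma1, a1) to (K/F, sigma2, a2) restricts
    to some tau in Gal(K/F). Applying f to t k = (sigma1 k) t shows that each
    nonzero monomial k_j t^j of f t satisfies sigma2^j tau = tau sigma1. As Gal(K/F) is
    abelian, this says sigma2^j = sigma1, so a single exponent j occurs:
    f t = c t^j with c <> 0.

    Secondly, for i + 1 < m the associators (x, t^i, t) vanish for all x in the
    source, hence so do the associators (y, f (t^i), f t) for all y in the
    target. Starting from f (t^i) = c_i t^(i j) with i j < m, taking y = t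
    forces i j + j < m, and then f (t^(i+1)) = f (t^i) f t is again a monomial,
    of exponent (i + 1) j. At i + 1 = m - 1 this gives (m - 1) j < m, so j <= 1
    as m >= 3. The value j = 0 would make sigma1 trivial, so j = 1 and
    sigma1 = sigma2. *)

Set Implicit Arguments.
Unset Strict Implicit.
Unset Printing Implicit Defensive.

Import GRing.Theory.
Local Open Scope ring_scope.

(** * Associators in nonassociative algebras *)

Definition na_assoc (F : fieldType) (A : naAlg F) (x y z : A) : A :=
  na_mul A (na_mul A x y) z - na_mul A x (na_mul A y z).

Lemma morph_na_assoc (F : fieldType) (A B : naAlg F) (f : {linear A -> B}) :
    {morph f : x y / na_mul A x y >-> na_mul B x y} ->
  forall x y z, f (na_assoc x y z) = na_assoc (f x) (f y) (f z).
Proof. by move=> fM x y z; rewrite /na_assoc linearB /= !fM. Qed.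

Section NaAssocSum.

Variables (F : fieldType) (A : naAlg F) (I : finType) (u : I -> A).

Lemma na_assoc_suml y z :
  na_assoc (\sum_i u i) y z = \sum_i na_assoc (u i) y z.
Proof. by rewrite /na_assoc !linear_sumlz [RHS]sumrB. Qed.

Lemma na_assoc_summ x z :
  na_assoc x (\sum_i u i) z = \sum_i na_assoc x (u i) z.
Proof.
by rewrite /na_assoc linear_sumlz !linear_sum linear_sumlz [RHS]big_split.
Qed.

Lemma na_assoc_sumr x y :
  na_assoc x y (\sum_i u i) = \sum_i na_assoc x y (u i).
Proof. by rewrite /na_assoc !linear_sum [RHS]big_split. Qed.

End NaAssocSum.

(** * Associators of monomials and the right nucleus *)

Section CyclicAssociator.

Variables (F : fieldType) (L : splittingFieldType F).
Local Notation m := (\dim {:L}).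

Lemma gal_expD (s : gal_of {:L}) i j k :
  (s ^+ (i + j))%g k = (s ^+ i)%g ((s ^+ j)%g k).
Proof. by rewrite addnC expgD galM ?memvf. Qed.

Lemma cyc_mono_eq0 (k : L) (s : nat) :
  (s < m)%N -> cyc_mono k s = 0 -> k = 0.
Proof. by move=> lt_s /ffunP/(_ (Ordinal lt_s)); rewrite !ffunE eqxx. Qed.

Lemma cyc_sum_mono_coef (c : 'I_m -> L) r :
  (\sum_(s < m) cyc_mono (c s) s : {ffun 'I_m -> L}) r = c r.
Proof.
rewrite (eq_bigr (fun s : 'I_m => cyc_mono ([ffun i => c i] s) s)) => [|s _].
  by rewrite cyc_sum_mono ffunE.
by rewrite ffunE.
Qed.

Variables (sigma : gal_of {:L}) (a : L).
Hypothesis sigma_m : (sigma ^+ m)%g = 1%g.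
Local Notation A := (cycAlg sigma a).

Lemma gal_expBm i : (m <= i)%N -> (sigma ^+ (i - m))%g = (sigma ^+ i)%g.
Proof. by move=> le_mi; rewrite -{2}(subnK le_mi) expgD sigma_m mulg1. Qed.

Lemma cycAlg_mul_mono k i k' j : (i < m)%N -> (j < m)%N ->
  na_mul A (cyc_mono k i) (cyc_mono k' j) = cyc_mono_mul sigma a k i k' j.
Proof. exact: cyc_mul_mono. Qed.

(** A reduction t^m -> a inserts a to the right of all Galois twists, so its
    place among the factors is visible only when it happens inside the right
    factor, that is, when j + l >= m. *)
Lemma cyc_assoc_mono (x : A) k j k' l : (j + l < m)%N ->
  na_assoc x (cyc_mono k j : A) (cyc_mono k' l : A) = 0.
Proof.
move=> lt_jl.
have lt_j : (j < m)%N by apply: leq_ltn_trans lt_jl; apply: leq_addr.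
have lt_l : (l < m)%N by apply: leq_ltn_trans lt_jl; apply: leq_addl.
rewrite -[x]cyc_sum_mono na_assoc_suml big1 // => i _.
have lt_i := ltn_ord i.
apply/eqP; rewrite subr_eq0; apply/eqP.
rewrite !cycAlg_mul_mono // /cyc_mono_mul lt_jl.
rewrite cycAlg_mul_mono // /cyc_mono_mul addnA rmorphM /= -gal_expD !mulrA.
case: (ltnP (i + j) m) => [lt_ij | le_ij].
  by rewrite cycAlg_mul_mono // /cyc_mono_mul.
have lt_ijm : (i + j - m < m)%N.
  by rewrite ltn_subLR // -addnS leq_add // ltnW.
have le_ijl : (m <= i + j + l)%N by rewrite (leq_trans le_ij) ?leq_addr.
have lt_ijl : (i + j - m + l < m)%N.
  by rewrite addnBAC // ltn_subLR // -addnA -addnS leq_add // ltnW.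
rewrite cycAlg_mul_mono // /cyc_mono_mul lt_ijl ltnNge le_ijl /=.
by rewrite gal_expBm // addnBAC // mulrAC.
Qed.

(** A reduction inside the right factor turns a into sigma a, since t stands on
    its left; a reduction made elsewhere leaves a alone. The monomial that
    remains needs no second reduction because (j + l - m) + 1 < m. *)
Lemma cyc_assoc_t k j k' l : (1 < m)%N -> (j < m)%N -> (l < m)%N ->
    (m <= j + l)%N ->
  na_assoc (cyc_mono 1 1 : A) (cyc_mono k j : A) (cyc_mono k' l : A)
    = cyc_mono (sigma k * (sigma ^+ j.+1)%g k' * (a - sigma a)) (j + l - m).+1.
Proof.
move=> lt_1 lt_j lt_l le_jl.
have lt_jlm : ((j + l - m).+1 < m)%N.
  by rewrite -subSn // ltn_subLR ?leqW // -addSn -addnS leq_add.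
rewrite /na_assoc !cycAlg_mul_mono // /cyc_mono_mul [(j + l < _)%N]ltnNge le_jl /=.
rewrite [X in _ - X]cycAlg_mul_mono ?(ltnW lt_jlm) // /cyc_mono_mul add1n lt_jlm.
rewrite mul1r expg1 !rmorphM /= -(gal_expD sigma 1) add1n.
set c := sigma k * _.
suff ->: na_mul A (if (1 + j < m)%N then cyc_mono (sigma k) (1 + j)
                   else cyc_mono (sigma k * a) (1 + j - m)) (cyc_mono k' l)
         = cyc_mono (c * a) (j + l - m).+1.
  apply/ffunP=> r; rewrite !ffunE.
  by rewrite add1n mul1r; case: eqP => _; rewrite ?subr0 // mulrBr.
rewrite add1n; case: ltnP => [lt_j1 | le_j1].
  by rewrite cycAlg_mul_mono // /cyc_mono_mul addSn ltnNge leqW //= subSn.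
have def_j : j.+1 = m by apply/eqP; rewrite eqn_leq lt_j le_j1.
rewrite /c -subSn // -addSn def_j subnn addKn.
rewrite cycAlg_mul_mono ?(ltnW lt_1) // /cyc_mono_mul add0n lt_l.
by rewrite sigma_m expg0 mulrAC.
Qed.

Lemma cyc_assoc_K (x y : A) k : na_assoc x y (cyc_mono k 0 : A) = 0.
Proof.
rewrite -[y]cyc_sum_mono na_assoc_summ big1 // => j _.
by rewrite cyc_assoc_mono // addn0.
Qed.

Lemma cyc_mono_mulK k i k' : (i < m)%N ->
  na_mul A (cyc_mono k i) (cyc_mono k' 0) = cyc_mono (k * (sigma ^+ i)%g k') i.
Proof.
by move=> lt_i; rewrite cycAlg_mul_mono ?adim_gt0 // /cyc_mono_mul addn0 lt_i.
Qed.

Lemma cyc_K_mul_mono k i k' : (i < m)%N ->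
  na_mul A (cyc_mono k 0) (cyc_mono k' i) = cyc_mono (k * k') i.
Proof.
move=> lt_i; rewrite cycAlg_mul_mono ?adim_gt0 // /cyc_mono_mul add0n lt_i.
by rewrite expg0 gal_id.
Qed.

Lemma cyc_mulK_coef (x : {ffun 'I_m -> L}) k r :
  (na_mul A x (cyc_mono k 0) : {ffun 'I_m -> L}) r = x r * (sigma ^+ r)%g k.
Proof.
rewrite -{1}(cyc_sum_mono x) linear_sumlz.
under eq_bigr do rewrite cyc_mono_mulK //.
exact: cyc_sum_mono_coef.
Qed.

Lemma cyc_K_mul_coef (x : {ffun 'I_m -> L}) k r :
  (na_mul A (cyc_mono k 0) x : {ffun 'I_m -> L}) r = k * x r.
Proof.
rewrite -{1}(cyc_sum_mono x) linear_sum /=.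
under eq_bigr do rewrite cyc_K_mul_mono //.
exact: cyc_sum_mono_coef.
Qed.

Hypothesis sigma_a : sigma a != a.
Hypothesis m_gt1 : (1 < m)%N.

(** The associators (t, t^(m-1), z_l t^l), for l > 0, are the
    monomials z_l (a - sigma a) t^l of distinct exponents, so they cannot
    cancel each other. *)
Lemma cyc_right_nucleus (z : A) :
    (forall x y : A, na_assoc x y z = 0) ->
  exists k, z = cyc_mono k 0.
Proof.
move=> nuc_z; have m_gt0 := ltnW m_gt1.
pose zl (l : 'I_m) : L := (z : {ffun 'I_m -> L}) l.
exists (zl (Ordinal m_gt0)).
have lt_m1 : (m.-1 < m)%N by rewrite prednK.
have := nuc_z (cyc_mono 1 1 : A) (cyc_mono 1 m.-1 : A).
rewrite -{1}[z]cyc_sum_mono na_assoc_sumr => sum0.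
have m_le (l : 'I_m) : (0 < l)%N -> (m <= m.-1 + l)%N.
  by move=> l_gt0; rewrite -(prednK l_gt0) -addSnnS prednK ?leq_addr.
have z0 (l : 'I_m) : (0 < l)%N -> zl l = 0.
  move=> l_gt0.
  have [//|nz_l] := eqVneq (zl l) 0.
  move: sum0 => /ffunP/(_ l); rewrite sum_ffunE (bigD1 l) //=.
  rewrite big1 => [|i ne_il].
    rewrite cyc_assoc_t ?m_le // -subSn ?m_le //.
    rewrite -addSn prednK // addKn !ffunE eqxx addr0 rmorph1 mul1r sigma_m.
    rewrite gal_id => /eqP; rewrite mulf_eq0 (negPf nz_l) /= subr_eq0 eq_sym.
    by rewrite (negPf sigma_a).
  case: (posnP i) => [->|i_gt0]; first by rewrite cyc_assoc_K ffunE.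
  rewrite cyc_assoc_t ?m_le // -subSn ?m_le //.
  by rewrite -addSn prednK // addKn ffunE val_eqE eq_sym (negPf ne_il).
apply/ffunP=> l; rewrite ffunE; case: eqP => [l0|/eqP].
  by rewrite /zl; congr (_ _); apply: val_inj.
by rewrite -lt0n => /z0.
Qed.

(** Turns vanishing of an associator into a bound on exponents, which is what
    transports through an isomorphism. *)
Lemma cyc_assoc_t_eq0_ltn k j k' l : (j < m)%N -> (l < m)%N -> k != 0 -> k' != 0 ->
    na_assoc (cyc_mono 1 1 : A) (cyc_mono k j : A) (cyc_mono k' l : A) = 0 ->
  (j + l < m)%N.
Proof.
move=> lt_j lt_l nz_k nz_k' assoc0; case: ltnP => // le_jl.
move: assoc0; rewrite cyc_assoc_t // => /cyc_mono_eq0 => /(_ _)/eqP.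
rewrite -subSn // ltn_subLR ?leqW // -addSn -addnS leq_add // => /(_ isT).
rewrite !mulf_eq0 !fmorph_eq0 (negPf nz_k) (negPf nz_k') subr_eq0 eq_sym.
by rewrite (negPf sigma_a).
Qed.

End CyclicAssociator.

(** * Generators of the Galois group *)

Lemma order_galois_generator (F : fieldType) (L : splittingFieldType F)
    (sigma : gal_of {:L}) :
    galois 1 {:L} -> generator 'Gal({:L} / 1) sigma ->
  #[sigma]%g = \dim {:L}.
Proof.
by move=> galL /eqP gen; rewrite orderE -gen -(galois_dim galL) dimv1 divn1.
Qed.

(** Being fixed by a generator means being fixed by Gal(K/F), that is, being
    in F. *)
Lemma galois_generator_nfix (F : fieldType) (L : splittingFieldType F)
    (sigma : gal_of {:L}) (a : L) :
    galois 1 {:L} -> generator 'Gal({:L} / 1) sigma -> a \notin 1%VS ->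
  sigma a != a.
Proof.
move=> galL /eqP gen; apply: contraNneq => sigma_a.
rewrite -(galois_fixedField galL); apply/fixedFieldP=> [|x]; first exact: memvf.
rewrite gen => /cycleP[i ->]; elim: i => [|i IHi]; first by rewrite gal_id.
by rewrite expgSr galM ?memvf // IHi.
Qed.

(** Such a tau is injective, K being a field, hence bijective, K being finite
    over F. *)
Lemma galois_of_rmorph (F : fieldType) (L : splittingFieldType F) (tau : L -> L) :
    galois 1 {:L} -> linear tau -> tau 1 = 1 -> {morph tau : x y / x * y} ->
  exists2 s, s \in 'Gal({:L} / 1)%g & tau =1 s.
Proof.
move=> galL tauL tau1 tauM.
have tau_lin := GRing.isLinear.Build F L L *:%R tau tauL.
pose T : {linear L -> L} := HB.pack tau tau_lin.
have homT : kHom 1 {:L} (linfun T).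
  apply/kHomP; split=> [x y _ _|x /vlineP[c ->]].
    by rewrite !lfunE /= tauM.
  by rewrite lfunE (linearZ_LR T) /= tau1.
have [||s sG eq_s] := @kHom_to_gal _ _ 1%AS {:L}%AS {:L}%AS _ _ _ homT.
- by rewrite subvf subvv.
- by case/and3P: galL.
exists s => // x; have := eq_s x (memvf x).
by rewrite lfunE.
Qed.

(** * Non-isomorphism *)

Theorem theorem5p1 (F : fieldType) (L : splittingFieldType F)
    (galL : galois 1 {:L}) (cycL : cyclic 'Gal({:L} / 1))
    (m : nat) (dimL : \dim {:L} = m) (m_ge3 : (3 <= m)%N)
    (sigma1 sigma2 : gal_of {:L})
    (gen1 : generator 'Gal({:L} / 1) sigma1)
    (gen2 : generator 'Gal({:L} / 1) sigma2)
    (neq_sigma : sigma1 <> sigma2)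
    (a1 a2 : L) (a1_notF : a1 \notin 1%VS) (a2_notF : a2 \notin 1%VS) :
  ~ naAlg_isomorphic (cycAlg sigma1 a1) (cycAlg sigma2 a2).
Proof.
case=> f [[g fK gK] f1 fM].
have o1 := order_galois_generator galL gen1.
have o2 := order_galois_generator galL gen2.
have s1m : (sigma1 ^+ \dim {:L})%g = 1%g by rewrite -o1 expg_order.
have s2m : (sigma2 ^+ \dim {:L})%g = 1%g by rewrite -o2 expg_order.
have s2a := galois_generator_nfix galL gen2 a2_notF.
have m_gt2 : (2 < \dim {:L})%N by rewrite dimL.
have m_gt1 := ltnW m_gt2; have m_gt0 := ltnW m_gt1.
pose i0 := Ordinal m_gt0; pose A1 := cycAlg sigma1 a1; pose A2 := cycAlg sigma2 a2.
have fA := morph_na_assoc fM.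
pose tau (k : L) : L := (f (cyc_mono k 0 : A1) : {ffun 'I_(\dim {:L}) -> L}) i0.
have f_K k : f (cyc_mono k 0 : A1) = cyc_mono (tau k) 0.
  have [|c def_c] := @cyc_right_nucleus _ _ _ _ s2m s2a m_gt1
                       (f (cyc_mono k 0 : A1)).
    by move=> x y; rewrite -[x]gK -[y]gK -fA cyc_assoc_K // linear0.
  by rewrite def_c /tau def_c ffunE eqxx.
have tauL : linear tau.
  move=> c u v; rewrite {1}/tau cyc_mono_is_linear.
  by rewrite (linearP f c (cyc_mono u 0 : A1) (cyc_mono v 0 : A1)) !ffunE.
have tau1 : tau 1 = 1 by rewrite /tau f1 /= ffunE eqxx.
have mono_inj (u v : L) : cyc_mono u 0 = cyc_mono v 0 -> u = v.
  by move=> /ffunP/(_ i0); rewrite !ffunE eqxx.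
have tauM : {morph tau : x y / x * y}.
  move=> x y; apply: mono_inj.
  by rewrite -f_K -(@cyc_K_mul_mono _ _ sigma1 a1) // fM !f_K cyc_K_mul_mono.
have [s sG def_tau] := galois_of_rmorph galL tauL tau1 tauM.
have s1G : sigma1 \in 'Gal({:L} / 1)%g by rewrite (eqP gen1) cycle_id.
have abG : ('Gal({:L} / 1) \subset 'C('Gal({:L} / 1)))%g by apply: cyclic_abelian.
pose t : A1 := cyc_mono 1 1.
pose u : {ffun 'I_(\dim {:L}) -> L} := f t.
(* Compare the coefficients of t^j in the images of both sides of
   t k' = (sigma1 k') t, where tau k' = k. *)
have u_exp (j : 'I_(\dim {:L})) : u j != 0 -> (sigma2 ^+ j)%g = sigma1.
  move=> nz_uj; apply/eqP/gal_eqP => k _.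
  have def_k : k = s (s^-1%g k) by rewrite -galM ?memvf // mulVg gal_id.
  set k' := s^-1%g k in def_k.
  have : na_mul A2 (f t) (f (cyc_mono k' 0 : A1))
       = na_mul A2 (f (cyc_mono (sigma1 k') 0 : A1)) (f t).
    by rewrite -!fM cyc_mono_mulK // cyc_K_mul_mono // expg1 mul1r mulr1.
  rewrite !f_K => /ffunP/(_ j).
  rewrite cyc_mulK_coef cyc_K_mul_coef mulrC => /(mulIf nz_uj).
  rewrite !def_tau -def_k => ->.
  by rewrite -galM ?memvf // (centsP abG _ s1G _ sG) galM ?memvf // -def_k.
have [j nz_uj] : exists j, u j != 0.
  apply/existsP; apply: contraT; rewrite negb_exists => /forallP u0.
  have /eqP : f t = f 0.
    by rewrite linear0; apply/ffunP=> r; rewrite ffunE; apply/eqP/negPn/u0.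
  rewrite (can_eq fK) => /eqP/cyc_mono_eq0-/(_ m_gt1)/eqP.
  by rewrite oner_eq0.
(* Exponents below the order of sigma2 are determined by sigma2^j. *)
have ft : f t = cyc_mono (u j) j.
  apply/ffunP=> r; rewrite ffunE; case: eqP => [/val_inj -> // | ne_rj].
  apply/eqP; apply: contraT => /u_exp; rewrite -(u_exp _ nz_uj) => /eqP.
  by rewrite eq_expg_mod_order o2 !modn_small // => /eqP.
have ft_exp i : (i < \dim {:L})%N ->
  (i * j < \dim {:L})%N /\
  exists2 c, c != 0 & f (cyc_mono 1 i : A1) = cyc_mono c (i * j).
  elim: i => [_|i IHi lt_i].
    by split; [rewrite mul0n | exists 1; rewrite ?oner_neq0 // f1].
  have [lt_ij [c nz_c fti]] := IHi (ltnW lt_i).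
  have lt_iSj : (i * j + j < \dim {:L})%N.
    (* cyc_mono 1 1 of the target is f of some x, and (x, t^i, t) = 0. *)
    apply: (cyc_assoc_t_eq0_ltn s2m s2a m_gt1 lt_ij (ltn_ord j) nz_c nz_uj).
    rewrite -fti -ft -[cyc_mono 1 1 : A2]gK -fA cyc_assoc_mono ?linear0 //.
    by rewrite addn1.
  rewrite mulSnr; split=> //; exists (c * (sigma2 ^+ (i * j))%g (u j)).
    by rewrite mulf_neq0 ?fmorph_eq0.
  have ->: cyc_mono 1 i.+1 = na_mul A1 (cyc_mono 1 i) t.
    rewrite cycAlg_mul_mono ?(ltnW lt_i) // /cyc_mono_mul addn1 lt_i.
    by rewrite mul1r rmorph1.
  by rewrite fM fti ft cycAlg_mul_mono // /cyc_mono_mul lt_iSj.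
have [|lt_jm _] := ft_exp (\dim {:L}).-1; first by rewrite prednK.
case: neq_sigma; rewrite -(u_exp _ nz_uj).
have le_j1 : (j <= 1)%N.
  rewrite leqNgt; apply: contraL lt_jm => lt_1j; rewrite -leqNgt.
  apply: (@leq_trans ((\dim {:L}).-1 * 2)); last by rewrite leq_mul2l lt_1j orbT.
  by rewrite muln2 -addnn -{1}(prednK m_gt0) -addn1 leq_add2l -ltnS prednK.
case: (val j) le_j1 (u_exp _ nz_uj) => [|[|//]] _ def_s1; last by rewrite expg1.
(* The exponent 0 would make the generator sigma1 trivial. *)
by move: m_gt1; rewrite -o1 -def_s1 expg0 order1.
Qed.
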